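(* There is a sequence of polynomials $(\Phi_d(x))_{d\ge 1}$ with $\Phi_d(x)\in\mathbb{Z}[x]$ such that for every integer $n\ge 1$ $$Z_n(x)=\prod_{d\mid n}\Phi_d(x),$$ and $\deg(\Phi_d)=\varphi(d)$ for every $d\ge 1$. Here $Z_n(x)$ is the $n$-th zpread polynomial and $\varphi$ is Euler's totient function.
   Context: The spread polynomials $(S_n(x))_{n\ge 1}$ are the polynomials uniquely determined by $S_n(\sin^2\theta)=\sin^2(n\theta)$ for all real $\theta$. The zpread polynomials are $Z_n(x)=4S_n(x/4)$. Equivalently, $Z_n(x)=2-L_n(2-x)$, where the Lucas polynomials $L_n(x)$ are defined by $L_0(x)=2$, $L_1(x)=x$ and $L_n(x)=xL_{n-1}(x)-L_{n-2}(x)$ for $n\ge 2$. The product runs over the positive divisors $d$ of $n$. *)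

(* Defs.v *)
From mathcomp Require Import all_boot all_order all_algebra.
From mathcomp Require Import all_classical all_reals all_analysis.
From mathcomp Require Import ring lra.

Set Implicit Arguments.
Unset Strict Implicit.
Unset Printing Implicit Defensive.

Import Order.TTheory GRing.Theory Num.Theory.
Import numFieldNormedType.Exports.

Local Open Scope ring_scope.
Local Open Scope classical_set_scope.

Definition is_spread_poly (R : realType) (n : nat) (p : {poly R}) : Prop :=
  forall theta : R, p.[sin theta ^+ 2] = sin (n%:R * theta) ^+ 2.

(* The default value 0 is never used, see spread_polyP. *)
Definition spread_poly (R : realType) (n : nat) : {poly R} :=
  xget 0 [set p : {poly R} | is_spread_poly n p].

Definition zpread_poly (R : realType) (n : nat) : {poly R} :=
  4 *: (spread_poly R n \Po (4^-1 *: 'X)).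

Lemma is_spread_poly_exists (R : realType) (n : nat) :
  exists p : {poly R}, is_spread_poly n p.
Proof.
suff [p [q [pP _]]] : exists p q : {poly R},
    is_spread_poly n p /\ is_spread_poly n.+1 q by exists p.
elim: n => [|n [p [q [pP qP]]]].
  exists 0, 'X; split=> t; first by rewrite mul0r sin0 horner0 expr0n.
  by rewrite mul1r hornerX.
exists q, ((2 - 4 *: 'X) * q - p + 2 *: 'X); split=> // t.
have -> : n.+2%:R * t = n.+1%:R * t + t by rewrite -[n.+2]addn1 natrD mulrDl mul1r.
have np : n%:R * t = n.+1%:R * t - t by rewrite -[n.+1]addn1 natrD mulrDl mul1r addrK.
have -> : (2 : {poly R}) = 2%:P by rewrite -polyC_natr.
rewrite !(hornerD, hornerN, hornerM, hornerZ, hornerC, hornerX) pP qP np sinB sinD.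
have := cos2sin2 t; have := cos2sin2 (n.+1%:R * t).
move: (sin t) (cos t) (sin _) (cos _) => s c A B HB Hc.
by ring: HB Hc.
Qed.

Lemma is_spread_poly_unique (R : realType) (n : nat) (p q : {poly R}) :
  is_spread_poly n p -> is_spread_poly n q -> p = q.
Proof.
move=> pP qP; apply/eqP; rewrite -subr_eq0; apply/eqP.
pose s := [seq (i.+1%:R^-1 : R) ^+ 2 | i <- iota 0 (size (p - q))].
apply: (@roots_geq_poly_eq0 _ _ s); last by rewrite size_map size_iota.
  apply/allP => _ /mapP[i _ ->]; rewrite rootE.
  have i01 : -1 <= (i.+1%:R^-1 : R) <= 1.
    rewrite invf_le1 ?ltr0n// ler1n andbT.
    by rewrite (le_trans (lerN10 _))// invr_ge0 ler0n.
  by have [_ <-] := asin_def i01; rewrite hornerD hornerN pP qP subrr.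
rewrite map_inj_uniq ?iota_uniq// => i j /eqP.
by rewrite eqrXn2 ?invr_ge0 ?ler0n// => /eqP/invr_inj/eqP; rewrite eqr_nat => /eqP[].
Qed.

Lemma spread_polyP (R : realType) (n : nat) : is_spread_poly n (spread_poly R n).
Proof. exact: (xgetPex 0 (is_spread_poly_exists R n)). Qed.

(* Main.v *)
Require Import Defs.
From mathcomp Require Import all_boot all_order all_algebra.
From mathcomp Require Import all_classical all_reals all_analysis.
From mathcomp Require Import ring lra cyclotomic.

(** If [z * w = 1], then [Z_n] at [2 - z - w] equals [2 - z ^ n - w ^ n]: with
    [z] the exponential of [2 * i * theta] this is the definition
    [Z_n(4 sin^2 theta) = 4 sin^2 (n theta)], and it holds for every invertible
    [z] because both sides satisfy the same three-term recurrence in [n].  The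
    right-hand side is [(z ^ n - 1) * (w ^ n - 1)], so the factorization of
    [X ^ n - 1] into the cyclotomic polynomials ['Phi_d] splits [Z_n] into
    factors whose values at [2 - z - w] are [('Phi_d).[z] * ('Phi_d).[w]].

    Such a factor is an integer polynomial in [2 - z - w].  Let [A] be the
    companion matrix of ['Phi_d]; the constant coefficient of ['Phi_d] divides
    that of [X ^ n - 1], so [A] is invertible over the integers.  From
    [(z - A)(w - A) = A ((2 - z - w) - (2 - A - A^-1))] it follows that
    [\det A] times the characteristic polynomial of [2 - A - A^-1] is the
    required factor.  It has the degree of ['Phi_d], that is [totient d], since
    [\det A] is a unit and characteristic polynomials are monic
    (lemmas [horner_folded_char_poly] and [size_zpread_factor]).

    Two real polynomials that agree at all points [2 - z - w] with [z * w = 1]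
    are equal, as these points form an infinite set. *)

Set Implicit Arguments.
Unset Strict Implicit.
Unset Printing Implicit Defensive.

Import Order.TTheory GRing.Theory Num.Theory.

Local Open Scope ring_scope.

Section FoldedCharPoly.
Variables (K : comNzRingType) (n : nat).
Implicit Types (A B : 'M[K]_n) (z w : K).

(** For [B] the inverse of [A], this is the product of [a * (x - 2 + a + a^-1)]
    over the eigenvalues [a] of [A]: the spectrum is folded along the
    map [a |-> 2 - a - a^-1], which identifies [a] with [a^-1].  The inverse is a
    separate argument so that the construction commutes with ring morphisms
    between rings in which inversion need not make sense. *)
Definition folded_char_poly A B : {poly K} :=
  \det A *: char_poly (2%:M - A - B).

Lemma horner_char_poly A z : (char_poly A).[z] = \det (z%:M - A).
Proof.
rewrite -horner_evalE -det_map_mx; congr (\det _).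
apply/matrixP => i j; rewrite !mxE /= !horner_evalE.
by rewrite hornerD hornerN hornerMn hornerX hornerC.
Qed.

(** The matrix form of [(z - a)(w - a) = a ((2 - z - w) - (2 - a - a^-1))]. *)
Lemma horner_folded_char_poly A B z w : A *m B = 1%:M -> z * w = 1 ->
  (folded_char_poly A B).[2 - z - w] = (char_poly A).[z] * (char_poly A).[w].
Proof.
move=> AB1 zw1; rewrite hornerZ !horner_char_poly -!det_mulmx; congr (\det _).
rewrite !mulmxBl !mulmxBr AB1 -!scalar_mxM zw1 !mul_scalar_mx !mul_mx_scalar.
apply/matrixP => i j; rewrite !mxE; move: (i == j) (\sum_k _) => [] S.
  by rewrite /=; ring.
by rewrite /=; ring.
Qed.

End FoldedCharPoly.

Lemma map_folded_char_poly (K L : comNzRingType) (f : {rmorphism K -> L}) n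
    (A B : 'M[K]_n) :
  map_poly f (folded_char_poly A B) =
  folded_char_poly (map_mx f A) (map_mx f B).
Proof.
rewrite /folded_char_poly map_polyZ map_char_poly det_map_mx.
by rewrite !map_mxB map_scalar_mx rmorph_nat.
Qed.

(** Evaluating the factorization of [X ^ n - 1] at [0] exhibits the constant
    coefficient as a divisor of [-1]. *)
Lemma Cyclotomic_coef0_unit n : (0 < n)%N -> ('Phi_n)`_0 \is a GRing.unit.
Proof.
move=> n_gt0; have n_n : n \in divisors n by rewrite -dvdn_divisors.
have := congr1 (fun p : {poly int} => p.[0]) (prod_Cyclotomic n_gt0).
rewrite (big_rem n n_n) /= hornerM hornerD hornerN hornerXn hornerC expr0n.
rewrite eqn0Ngt n_gt0 sub0r horner_coef0 => PhiM.
have : ('Phi_n)`_0 * (\prod_(d <- rem n (divisors n)) 'Phi_d).[0] \is a GRing.unit.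
  by rewrite PhiM unitrN1.
by rewrite unitrM => /andP[].
Qed.

Definition zpread_factor (d : nat) : {poly int} :=
  let A := companionmx 'Phi_d in folded_char_poly A (invmx A).

Section ZpreadFactor.
Variables (d : nat).
Hypothesis d_gt0 : (0 < d)%N.

Lemma unitmx_companion_Cyclotomic : companionmx 'Phi_d \in unitmx.
Proof.
have := Cyclotomic_coef0_unit d_gt0.
rewrite -{1}(companionmxK (Cyclotomic_monic d)) char_poly_det.
by rewrite unitrM => /andP[].
Qed.

Lemma size_zpread_factor : size (zpread_factor d) = (totient d).+1.
Proof.
have := unitmx_companion_Cyclotomic; rewrite unitmxE => uA.
rewrite size_scale ?size_char_poly ?size_Cyclotomic//.
by apply: contraTneq uA => ->; rewrite unitr0.
Qed.

Lemma horner_zpread_factor (F : fieldType) (z w : F) : z * w = 1 ->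
  (map_poly intr (zpread_factor d)).[2 - z - w] =
  (map_poly intr 'Phi_d).[z] * (map_poly intr 'Phi_d).[w].
Proof.
move=> zw1; rewrite map_folded_char_poly horner_folded_char_poly//.
  by rewrite -map_char_poly companionmxK// Cyclotomic_monic.
by rewrite -map_mxM mulmxV ?map_mx1// unitmx_companion_Cyclotomic.
Qed.

End ZpreadFactor.

Lemma horner_prod_zpread_factor (F : fieldType) n (z w : F) :
  (0 < n)%N -> z * w = 1 ->
  (\prod_(d <- divisors n) map_poly intr (zpread_factor d)).[2 - z - w] =
  2 - z ^+ n - w ^+ n.
Proof.
move=> n_gt0 zw1; rewrite horner_prod.
have prodPhi x : \prod_(d <- divisors n) (map_poly intr 'Phi_d).[x] = x ^+ n - 1 :> F.
  rewrite -horner_prod -rmorph_prod prod_Cyclotomic// rmorphB /= map_polyXn.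
  by rewrite rmorph1 hornerD hornerN hornerXn hornerC.
transitivity ((z ^+ n - 1) * (w ^+ n - 1)); last first.
  by rewrite mulrBl mulrBr -exprMn zw1 expr1n; ring.
rewrite -!prodPhi -big_split /=; apply: eq_big_seq => d.
rewrite -dvdn_divisors// => /(dvdn_gt0 n_gt0) d_gt0.
exact: horner_zpread_factor.
Qed.

Section Zpread.
Variable R : realType.

Lemma spread_poly0 : spread_poly R 0 = 0.
Proof.
apply: (is_spread_poly_unique (@spread_polyP R 0)) => t.
by rewrite mul0r sin0 horner0 expr0n.
Qed.

Lemma spread_poly1 : spread_poly R 1 = 'X.
Proof.
apply: (is_spread_poly_unique (@spread_polyP R 1)) => t.
by rewrite mul1r hornerX.
Qed.

(** The addition formulas express [sin ((n + 1) t +/- t) ^ 2] through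
    [sin ((n + 1) t) ^ 2] once the two are added, which removes the mixed term
    containing cosines to an odd power. *)
Lemma spread_polySS n : spread_poly R n.+2 =
  (2 - 4 *: 'X) * spread_poly R n.+1 - spread_poly R n + 2 *: 'X.
Proof.
apply: (is_spread_poly_unique (@spread_polyP R n.+2)) => t.
have -> : n.+2%:R * t = n.+1%:R * t + t by rewrite -[n.+2]addn1 natrD mulrDl mul1r.
have Dn : n%:R * t = n.+1%:R * t - t by rewrite -[n.+1]addn1 natrD mulrDl mul1r addrK.
have -> : (2 : {poly R}) = 2%:P by rewrite -polyC_natr.
rewrite !(hornerD, hornerN, hornerM, hornerZ, hornerC, hornerX) !spread_polyP Dn.
rewrite sinB sinD; have := cos2sin2 t; have := cos2sin2 (n.+1%:R * t).
move: (sin t) (cos t) (sin _) (cos _) => s c u v Hv Hc.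
by ring: Hv Hc.
Qed.

Lemma horner_zpreadE n (x : R) :
  (zpread_poly R n).[x] = 4 * (spread_poly R n).[4^-1 * x].
Proof. by rewrite hornerZ horner_comp hornerZ hornerX. Qed.

(** The definition only controls [Z_n] on the interval from [0] to [4], whereas
    [2 - z - w] lies outside its interior for real [z]; the recurrence carries
    the closed form over. *)
Lemma horner_zpread_poly n (z w : R) : z * w = 1 ->
  (zpread_poly R n).[2 - z - w] = 2 - z ^+ n - w ^+ n.
Proof.
move=> zw1.
suff [] : (zpread_poly R n).[2 - z - w] = 2 - z ^+ n - w ^+ n /\
  (zpread_poly R n.+1).[2 - z - w] = 2 - z ^+ n.+1 - w ^+ n.+1 by [].
elim: n => [|n [IHn IHn1]]; rewrite !horner_zpreadE.
  rewrite spread_poly0 spread_poly1 horner0 hornerX; split; first by ring.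
  by field.
split; first by rewrite -horner_zpreadE.
rewrite spread_polySS.
have -> : (2 : {poly R}) = 2%:P by rewrite -polyC_natr.
rewrite !(hornerD, hornerN, hornerM, hornerZ, hornerC, hornerX).
move: IHn IHn1; rewrite !horner_zpreadE.
set a := horner _ _; set b := horner _ _ => Ha Hb.
transitivity ((2 - (2 - z - w)) * (4 * b) - (4 * a) + 2 * (2 - z - w)).
  by field.
rewrite Ha Hb.
by rewrite !exprS; ring: zw1.
Qed.

Lemma add_inv_inj_ge1 (z w : R) :
  1 <= z -> 1 <= w -> z + z^-1 = w + w^-1 -> z = w.
Proof.
move=> z1 w1 /eqP; rewrite -subr_eq0 => /eqP E.
have z0 : z != 0 by rewrite gt_eqF// (lt_le_trans ltr01).
have w0 : w != 0 by rewrite gt_eqF// (lt_le_trans ltr01).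
(* The difference of the two sums is [(z - w) * (z * w - 1) / (z * w)]; the
   second factor vanishes on this domain only when [z = w = 1]. *)
have /eqP : (z - w) * (z * w - 1) = 0.
  by rewrite -[RHS](mulr0 (z * w)) -E; field; rewrite z0 w0.
rewrite mulf_eq0 !subr_eq0 => /orP[/eqP//|/eqP zw].
have -> : z = 1 by nra.
by nra.
Qed.

Lemma eq_poly_on_sums_inv (p q : {poly R}) :
  (forall z w, z * w = 1 -> p.[2 - z - w] = q.[2 - z - w]) -> p = q.
Proof.
move=> pq; apply/eqP; rewrite -subr_eq0; apply/eqP.
pose x (i : nat) : R := 2 - i.+1%:R - i.+1%:R^-1.
apply: (@roots_geq_poly_eq0 _ _ (map x (iota 0 (size (p - q))))).
- apply/allP => _ /mapP[i _ ->]; rewrite rootE hornerD hornerN pq ?subrr//.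
  by rewrite divff// pnatr_eq0.
- rewrite map_inj_uniq ?iota_uniq// => i j xij.
  have /eqP : i.+1%:R = j.+1%:R :> R.
    apply: add_inv_inj_ge1; rewrite ?ler1n//.
    by apply: oppr_inj; apply: (addrI 2); rewrite !opprD !addrA.
  by rewrite eqr_nat => /eqP[].
- by rewrite size_map size_iota.
Qed.

End Zpread.

Theorem theorem1p1 (R : realType) :
  exists Phi : nat -> {poly int},
    (forall n : nat, (1 <= n)%N ->
       zpread_poly R n = \prod_(d <- divisors n) map_poly intr (Phi d)) /\
    (forall d : nat, (1 <= d)%N -> size (Phi d) = (totient d).+1).
Proof.
exists zpread_factor; split=> [n n_gt0|d]; last exact: size_zpread_factor.
apply: eq_poly_on_sums_inv => z w zw1.
by rewrite horner_zpread_poly// horner_prod_zpread_factor.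
Qed.
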